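(* Let $(X,\|\cdot\|)$ be an infinite-dimensional Fréchet space and let $\mathcal{V}=\{V_n\}_{n\in\mathbb{N}}$ be a nested sequence of linear subspaces of $X$ satisfying $\overline{V_n}\subseteq V_{n+1}$ for every $n\in\mathbb{N}$. Let $\{e_n\}_{n\in\mathbb{N}}$ be a decreasing sequence of positive real numbers and $\{\delta_n\}_{n\in\mathbb{N}}$ a sequence of positive numbers such that for every $n\in\mathbb{N}$ $$\sum_{j=n}^{\infty}2^{j-n}(e_j+\delta_j)<\min\{e_{n-1},d_{n,\mathcal{V}}\},$$ where $e_0=\infty$. Then there exists $x\in X$ such that $\mathrm{dist}(x,V_n)=e_n$ for every $n\in\mathbb{N}$.
   Context: $\mathbb{N}=\{1,2,\dots\}$. A Fréchet space $(X,\|\cdot\|)$ is a (real or complex) metric linear space which is complete with respect to an F-norm $\|\cdot\|$ giving its topology; an F-norm satisfies $\|x\|=0$ iff $x=0$, $\|\alpha x\|=\|x\|$ for all scalars with $|\alpha|=1$, and $\|x+y\|\leq\|x\|+\|y\|$ (no local convexity is assumed; scalar multiplication is continuous). Closures are taken with respect to $\|\cdot\|$. For $x\in X$, $\rho_n(x)=\mathrm{dist}(x,V_n)=\inf\{\|x-v\|:v\in V_n\}$, and $d_{n,\mathcal{V}}=\sup\{\rho_n(v):v\in V_{n+1}\}\in[0,\infty]$. If $d_{1,\mathcal{V}}=\infty$, the condition for $n=1$ means that the series on the left converges. *)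

(* Defs.v *)
From HB Require Import structures.
From mathcomp Require Import all_boot all_order all_algebra.
From mathcomp Require Import complex.
From mathcomp Require Import boolp classical_sets reals ereal topology.
From mathcomp Require Import normedtype sequences.

Set Implicit Arguments.
Unset Strict Implicit.
Unset Printing Implicit Defensive.

Import Order.TTheory GRing.Theory Num.Theory.

Local Open Scope classical_set_scope.
Local Open Scope ring_scope.

Variant scalar_kind := RealScalars | ComplexScalars.

Definition scalar_field (R : realType) (k : scalar_kind) : numFieldType :=
  match k with
  | RealScalars => R
  | ComplexScalars => R[i]
  end.

(* Nonnegativity follows from the axioms: 0 = N (x - x) <= N x + N (- x), and
   N (- x) = N x because `|-1| = 1. *)
Record is_Fnorm (R : realType) (K : numFieldType) (X : lmodType K)
    (N : X -> R) : Prop := IsFnorm {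
  Fnorm_eq0 : forall x, N x = 0 <-> x = 0;
  Fnorm_unitZ : forall (a : K) (x : X), `|a| = 1 -> N (a *: x) = N x;
  Fnorm_triangle : forall x y, N (x + y) <= N x + N y
}.

(* Continuity of addition and of scalar multiplication is part of
   topologicalLmodType; local convexity is not. *)
Record is_Frechet (R : realType) (K : numFieldType)
    (X : topologicalLmodType K) (N : X -> R) : Prop := IsFrechet {
  Frechet_Fnorm : is_Fnorm N;
  Frechet_nbhs : forall x : X,
    nbhs x = filter_from [set eps : R | 0 < eps]
                         (fun eps => [set y | N (x - y) < eps]);
  Frechet_complete : forall u : nat -> X,
    (forall eps : R, 0 < eps -> exists M : nat, forall m n : nat,
       (M <= m)%N -> (M <= n)%N -> N (u m - u n) < eps) ->
    exists l : X, u @ \oo --> l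
}.

Definition finite_dimensional (K : numFieldType) (X : lmodType K) : Prop :=
  exists (n : nat) (b : 'I_n -> X), forall x : X,
    exists c : 'I_n -> K, x = \sum_(i < n) c i *: b i.

Definition dist (R : realType) (K : numFieldType) (X : lmodType K)
    (N : X -> R) (x : X) (A : set X) : R :=
  inf [set N (x - v) | v in A].

Definition deviation (R : realType) (K : numFieldType) (X : lmodType K)
    (N : X -> R) (V : nat -> set X) (n : nat) : \bar R :=
  ereal_sup [set (dist N v (V n))%:E | v in V n.+1].

(* All sequences are indexed by n >= 1; the junk value e 0 is replaced by the
   convention e_0 = +oo. *)
Definition e_ext (R : realType) (e : nat -> R) (n : nat) : \bar R :=
  if n is 0%N then +oo%E else (e n)%:E.

(* Main.v *)
Require Import Defs.
From mathcomp Require Import all_boot all_order all_algebra.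
From mathcomp Require Import boolp classical_sets reals ereal topology.
From mathcomp Require Import normedtype sequences.
From mathcomp Require Import complex finmap tvs lra.

(** The idea is to look for x as a series of terms z_n taken in V_(n+1).  Since
    z_0, ..., z_(n-1) lie in V_n, the distance from x to V_n depends only on the
    tail z_n + z_(n+1) + ..., so the prescribed distances can be met one after
    the other from the last index backwards: once the tail y after n is known,
    z_n is found by the intermediate value theorem along a segment [0, w], w in
    V_(n+1), applied to t |-> dist(tw + y, V_n).

    Let S_n be the sum of 2^(j-n) (e_j + delta_j) over j >= n, so that
    S_n = e_n + delta_n + 2 S_(n+1).  If every tail after n has size at most
    S_(n+1), the value e_n is reached as soon as dist(w, V_n) >= e_n + S_(n+1)
    and S_(n+1) < e_n; both are provided by the hypothesis, at n and at n+1.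
    At the parameter t that is found, dist(tw, V_n) <= e_n + S_(n+1), so
    subtracting an element of V_n brings the norm of tw down to
    e_n + S_(n+1) + delta_n = S_n - S_(n+1), and the tail starting at n has size
    at most S_n: this is the equation that dictates the weights 2^(j-n).

    The backward construction needs a last index, hence a passage to the limit.
    By compactness of the set of parameters t, finitely many elements of V_n are
    enough for the subtraction, whatever t and y are; so z_n can be taken in a
    compact set C_n that does not depend on y (compact_level).  The element of
    V_n that is subtracted may jump as t varies; this is harmless because the
    intermediate value theorem is applied to distances to V_n, which do not see
    it.  Finite solutions then converge along an
    ultrafilter, term by term, and since the tails are at most S_n, uniformly
    small, the limit series converges and has the prescribed distances
    (exists_prescribed_distances). *)

Import Order.TTheory GRing.Theory Num.Theory.
Import numFieldNormedType.Exports.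

Local Open Scope classical_set_scope.
Local Open Scope ring_scope.

Set Implicit Arguments.
Unset Strict Implicit.
Unset Printing Implicit Defensive.

(** * Linear subspaces given as sets *)

Section Subspace.
Context (K : numFieldType) (X : lmodType K) (W : set X).
Hypothesis subW : submod_closed [in W].

Lemma subspace0 : W 0.
Proof. by case: subW => [/set_mem]. Qed.

Lemma subspace_lin a x y : W x -> W y -> W (a *: x + y).
Proof.
move=> Wx Wy; apply: set_mem.
by case: subW => _ /(_ a x y); apply; exact: mem_set.
Qed.

Lemma subspaceZ a x : W x -> W (a *: x).
Proof.
by move=> Wx; rewrite -[_ *: _]addr0; apply: subspace_lin subspace0.
Qed.

Lemma subspaceD x y : W x -> W y -> W (x + y).
Proof. by move=> Wx Wy; rewrite -[x]scale1r; exact: subspace_lin. Qed.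

Lemma subspaceN x : W x -> W (- x).
Proof. by move=> Wx; rewrite -scaleN1r; exact: subspaceZ. Qed.

End Subspace.

(** * F-norms and the distance to a subspace *)

Section FNorm.
Context (R : realType) (K : numFieldType) (X : lmodType K) (N : X -> R).
Hypothesis FN : is_Fnorm N.

Lemma Fnorm0 : N 0 = 0.
Proof. by apply/(Fnorm_eq0 FN). Qed.

Lemma FnormN x : N (- x) = N x.
Proof. by rewrite -scaleN1r (Fnorm_unitZ FN) // normrN1. Qed.

Lemma Fnorm_distC x y : N (x - y) = N (y - x).
Proof. by rewrite -FnormN opprB. Qed.

Lemma Fnorm_ge0 x : 0 <= N x.
Proof.
by have := Fnorm_triangle FN x (- x); rewrite subrr Fnorm0 FnormN; lra.
Qed.

Lemma Fnorm_path z x y : N (x - y) <= N (x - z) + N (z - y).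
Proof. by have := Fnorm_triangle FN (x - z) (z - y); rewrite addrA subrK. Qed.

Context (W : set X).
Hypothesis subW : submod_closed [in W].

Lemma dist_le x v : W v -> dist N x W <= N (x - v).
Proof.
move=> Wv; apply: ge_inf; last by exists v.
by exists 0 => _ [u _ <-]; exact: Fnorm_ge0.
Qed.

Lemma dist_le_Fnorm x : dist N x W <= N x.
Proof. by rewrite -[x in leRHS]subr0; apply: dist_le; exact: subspace0. Qed.

Lemma dist_lt_ex x c : dist N x W < c -> exists2 v, W v & N (x - v) < c.
Proof.
move=> xc.
have [||_ [v Wv <-]] :=
  @inf_adherent _ [set N (x - v) | v in W] (c - dist N x W).
- by rewrite subr_gt0.
- split; first by exists (N (x - 0)), 0 => //; exact: subspace0.
  by exists 0 => _ [u _ <-]; exact: Fnorm_ge0.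
- by rewrite [ltRHS]addrC subrK => ?; exists v.
Qed.

(** Common source of the Lipschitz bound and of the invariance under
    translations by W. *)
Lemma dist_lip_mod x y w : W w -> dist N x W <= dist N y W + N (x - y - w).
Proof.
move=> Ww; apply/ler_addgt0Pr => eps eps_gt0.
have [v Wv yv] : exists2 v, W v & N (y - v) < dist N y W + eps.
  by apply: dist_lt_ex; rewrite ltrDl.
have := dist_le x (subspaceD subW Ww Wv).
have := Fnorm_triangle FN (x - y - w) (y - v).
have -> : x - y - w + (y - v) = x - (w + v).
  by rewrite opprD addrAC addrA subrK addrAC addrA.
lra.
Qed.

Lemma dist_lip x y : dist N x W <= dist N y W + N (x - y).
Proof. by rewrite -[x - y]subr0; exact: dist_lip_mod (subspace0 subW). Qed.

Lemma dist_translate x y : W (x - y) -> dist N x W = dist N y W.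
Proof.
suff le u v : W (u - v) -> dist N u W <= dist N v W.
  move=> Wxy; apply/eqP; rewrite eq_le !le // -opprB.
  exact: (subspaceN subW).
by move=> /(dist_lip_mod u v); rewrite subrr Fnorm0 addr0.
Qed.
End FNorm.

(** * Continuity and compactness in a Frechet space *)

Section FrechetTopology.
Context (R : realType) (K : numFieldType) (X : topologicalLmodType K).
Context (N : X -> R).
Hypothesis XF : is_Frechet N.
Let FN := Frechet_Fnorm XF.

Lemma Frechet_cvgP (F : set_system X) (FF : Filter F) (l : X) :
  F --> l <-> forall eps, 0 < eps -> F [set y | N (l - y) < eps].
Proof.
split=> [Fl eps eps0|FN' A].
  by apply: Fl; rewrite (Frechet_nbhs XF); exists eps.
by rewrite (Frechet_nbhs XF) => -[eps /= /FN' + sA]; apply: filterS.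
Qed.

Lemma Fnorm_lip_continuous (f : X -> R) :
  (forall x y, f x <= f y + N (x - y)) -> continuous f.
Proof.
move=> flip x; apply/cvgrPdist_lt => eps eps0.
have /(Frechet_cvgP (nbhs_filter x)) /(_ _ eps0) := @cvg_id _ (nbhs x).
apply: filterS => y /= xy; rewrite ltr_norml.
by have := flip x y; have := flip y x; rewrite (Fnorm_distC FN y); lra.
Qed.

Lemma Fnorm_continuous : continuous N.
Proof.
apply: Fnorm_lip_continuous => x y.
by have := Fnorm_path FN y x 0; rewrite !subr0 addrC.
Qed.

Lemma dist_continuous (W : set X) :
  submod_closed [in W] -> continuous (fun x => dist N x W).
Proof. by move=> subW; apply: Fnorm_lip_continuous; exact: dist_lip. Qed.

Lemma closed_Fnorm_le (b : R) : closed [set x | N x <= b].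
Proof.
apply: (@closed_comp _ _ N [set r | r <= b]) => [x _|]; last exact: closed_le.
exact: Fnorm_continuous.
Qed.

(** Modulo W the path p is lifted into the ball of radius b.  The lift jumps,
    but finitely many translates of p by elements of W are enough since the
    conditions N (p t - v) < b, v in W, are open in t and cover A. *)
Lemma compact_lift (p : R -> X) (A : set R) (W : set X) (b : R) :
  continuous p -> compact A -> submod_closed [in W] ->
  (forall t, A t -> dist N (p t) W < b) ->
  exists C : set X, [/\ compact C,
    forall z, C z -> N z <= b /\ exists t, W (z - p t) &
    forall t, A t -> exists2 z, C z & W (z - p t)].
Proof.
move=> pc Aco subW Ab.
have pv_cont v : continuous (fun t => p t - v).
  move=> t; apply/Frechet_cvgP => eps eps0.
  have /(Frechet_cvgP (fmap_filter _ _)) /(_ _ eps0) := pc t.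
  apply: (@filterS _ (nbhs t)) => s /=.
  by rewrite opprB addrA subrK.
pose U v := [set t | N (p t - v) < b].
have Uop v : W v -> open (U v).
  move=> _; apply: (@open_comp _ _ (fun t => N (p t - v)) [set r | r < b]).
    move=> t _; apply: continuous_comp (pv_cont v t) _.
    exact: Fnorm_continuous.
  exact: open_lt.
have AU : A `<=` cover W U.
  by move=> t /Ab /(dist_lt_ex FN subW) [v Wv tv]; exists v.
move: (Aco); rewrite compact_cover => /(_ _ _ _ Uop AU)[D DW AD].
exists (\bigcup_(v in [set` D])
  ([set p t - v | t in A] `&` [set x | N x <= b])); split.
- rewrite bigcup_fset; apply: bigsetU_compact => v _.
  apply: compact_closedI; last exact: closed_Fnorm_le.
  apply: continuous_compact => //.
  by apply: continuous_subspaceT; exact: pv_cont.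
- move=> z [v /= /DW /set_mem Wv [[t At <-] Nb]]; split=> //; exists t.
  by rewrite addrAC subrr sub0r; exact: subspaceN.
- move=> t At; have [v /= vD tv] := AD t At.
  exists (p t - v); first by exists v => //; split; [exists t|exact: ltW].
  by rewrite addrAC subrr sub0r; apply: subspaceN => //; apply/set_mem/DW.
Qed.

End FrechetTopology.

(** * One step: reaching a given distance *)

(** Provides the segments t |-> t w, t real, for real and complex scalars
    together. *)
Lemma scalar_line (R : realType) (k : scalar_kind) :
  exists iota : R -> (scalar_field R k)^o,
    [/\ iota 0 = 0, iota 1 = 1 & continuous iota].
Proof.
case: k => /=; first by exists id; split=> // x; exact: cvg_id.
exists (fun r => r%:C%C); split=> // r; apply/cvgrPdist_lt => eps.
case: eps => a b; rewrite ltcE /= => /andP[/eqP -> a0].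
have /cvgrPdist_lt/(_ _ a0) := @cvg_id _ (nbhs r).
apply: filterS => s /= rs.
by rewrite -rmorphB /= normc_def /= expr0n addr0 sqrtr_sqr ltcR.
Qed.

Section Level.
Context (R : realType) (K : numFieldType) (X : topologicalLmodType K).
Context (N : X -> R) (iota : R -> K^o).
Hypothesis XF : is_Frechet N.
Hypothesis iota0 : iota 0 = 0.
Hypothesis iota1 : iota 1 = 1.
Hypothesis iota_cont : continuous iota.
Let FN := Frechet_Fnorm XF.

Lemma line_continuous (w : X) : continuous (fun t => iota t *: w).
Proof.
move=> t; apply: (@continuous2_cvg _ _ _ _ (nbhs t) _ iota (fun=> w)
  (fun (a : K^o) (x : X) => a *: x)).
- exact: (scale_continuous (iota t, w)).
- exact: iota_cont.
- exact: cvg_cst.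
Qed.

(** Here s bounds the part y of the vector that is already known.  The compact
    set is independent of y: if dist (t w + y) W = c then t w is at distance at
    most c + s from W, so that only such t have to be lifted. *)
Lemma compact_level (W W' : set X) (w : X) (s c b : R) :
  submod_closed [in W] -> submod_closed [in W'] -> W `<=` W' -> W' w ->
  s < c -> c + s <= dist N w W -> c + s < b ->
  exists C : set X, [/\ compact C, C `<=` W', forall z, C z -> N z <= b &
    forall y, N y <= s -> exists2 z, C z & dist N (z + y) W = c].
Proof.
move=> subW subW' WW' W'w sc cw cb.
pose p t := iota t *: w.
have p_cont : continuous p := @line_continuous w.
pose A := `[0, 1]%classic `&` [set t : R | dist N (p t) W <= c + s].
have dp_cont y : continuous (fun t => dist N (p t + y) W).
  move=> t; apply: (@continuous_comp _ _ _ (fun t => p t + y)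
    (fun x => dist N x W)).
    apply/(Frechet_cvgP XF (fmap_filter _ _)) => eps eps0.
    have /(Frechet_cvgP XF (fmap_filter _ _)) /(_ _ eps0) := p_cont t.
    apply: (@filterS _ (nbhs t)) => r /=.
    by rewrite opprD addrACA subrr addr0.
  exact: (dist_continuous XF subW).
have Aco : compact A.
  apply: compact_closedI; first exact: segment_compact.
  apply: (@closed_comp _ _ (fun t => dist N (p t) W) [set r | r <= c + s]).
    by move=> t _; have := dp_cont 0 t; under eq_fun do rewrite addr0.
  exact: closed_le.
have [|C [Cco CN CA]] := compact_lift XF p_cont Aco subW (b := b).
  by move=> t [_ /= /le_lt_trans]; apply.
exists C; split=> //.
- move=> z /CN[_ [t Wt]]; rewrite -[z](subrK (p t)).
  by apply: subspaceD => //; [exact: WW'|exact: subspaceZ].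
- by move=> z /CN[].
- move=> y ys.
  have y_low : dist N y W <= s.
    by apply: le_trans ys; exact: dist_le_Fnorm.
  have y_high : c <= dist N (w + y) W.
    have := dist_lip FN subW w (w + y).
    by rewrite opprD addrA subrr sub0r (FnormN FN); lra.
  have [||| t t01 /= tc] := @IVT R (fun t => dist N (p t + y) W) 0 1 c.
  + exact: ler01.
  + exact: continuous_subspaceT.
  + rewrite /p iota0 iota1 scale0r scale1r add0r.
    by rewrite ge_min le_max y_high (le_trans y_low (ltW sc)) orbT.
  have [|z Cz Wz] := CA t.
    split=> //=; have := dist_lip FN subW (p t) (p t + y).
    by rewrite opprD addrA subrr sub0r (FnormN FN) tc; lra.
  exists z => //; rewrite -tc; apply: (dist_translate FN subW).
  by rewrite opprD addrACA subrr addr0.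
Qed.
End Level.

(** * All steps together: passage to the limit *)

(** The image of an ultrafilter is an ultrafilter, so that it converges as soon
    as it contains a compact set. *)
Lemma ultra_compact_cvg (I : Type) (T : topologicalType) (U : set_system I)
    (f : I -> T) (C : set T) : UltraFilter U -> compact C ->
  U (f @^-1` C) -> exists2 p, C p & f @ U --> p.
Proof.
move=> UU; rewrite compact_ultra => Cco UC.
have fUU : UltraFilter (f @ U).
  split=> [|G GG UG]; first exact: fmap_proper_filter.
  apply/seteqP; split=> // B GB.
  case: (in_ultra_setVsetC (f @^-1` B) UU) => // UnB.
  have /UG GnB : (f @ U) (~` B) by [].
  exfalso; apply: (@filter_not_empty _ G _).
  by rewrite -(setICr B); exact: filterI.
by have [p [Cp pU]] := Cco _ fUU UC; exists p.
Qed.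

Section BackwardSelection.
Context (R : realType) (K : numFieldType) (X : topologicalLmodType K).
Context (N : X -> R) (W C : nat -> set X) (S c : nat -> R).
Hypothesis XF : is_Frechet N.
Hypothesis subW : forall n, submod_closed [in W n].
Hypothesis W_nested : forall n, W n `<=` W n.+1.
Hypothesis C_compact : forall n, compact (C n).
Hypothesis CW : forall n, C n `<=` W n.+1.
Hypothesis CN : forall n z, C n z -> N z <= S n - S n.+1.
Hypothesis C_hit : forall n y, N y <= S n.+1 ->
  exists2 z, C n z & dist N (z + y) (W n) = c n.
Hypothesis S_ge0 : forall n, 0 <= S n.
Hypothesis S_cvg0 : forall eps, 0 < eps -> exists n, S n < eps.
Let FN := Frechet_Fnorm XF.

(** The first n conditions, met from the last one backwards; r j is the tail
    z_j + ... + z_(n-1). *)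
Lemma finite_prescribed_distances n : exists z r : nat -> X,
  [/\ forall j, (j < n)%N -> C j (z j) /\ dist N (r j) (W j) = c j,
      forall j, (j < n)%N -> r j = z j + r j.+1 &
      forall j, N (r j) <= S j].
Proof.
pose hits j y := [set z | C j z /\ dist N (z + y) (W j) = c j].
pose g j y := xget 0 (hits j y).
have gP j y : N y <= S j.+1 -> C j (g j y) /\ dist N (g j y + y) (W j) = c j.
  by move=> /C_hit[z Cz zc]; exact: (@xgetI _ 0 (hits j y) z).
pose tail := fix tail (m j : nat) {struct m} : X :=
  if m is m'.+1 then g j (tail m' j.+1) + tail m' j.+1 else 0.
have tailN m j : N (tail m j) <= S j.
  elim: m j => [|m IH] j /=; first by rewrite (Fnorm0 FN).
  have [Cg _] := gP _ _ (IH j.+1).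
  have := CN Cg; have := IH j.+1.
  by have := Fnorm_triangle FN (g j (tail m j.+1)) (tail m j.+1); lra.
exists (fun j => g j (tail (n - j.+1)%N j.+1)), (fun j => tail (n - j)%N j).
by split=> [j jn|j jn|j //]; rewrite -(subnSK jn) //=; exact: gP.
Qed.

Lemma W_mono m n : (m <= n)%N -> W m `<=` W n.
Proof.
elim: n => [|n IH]; first by rewrite leqn0 => /eqP ->.
by rewrite leq_eqVlt => /predU1P[-> //|/IH mn x /mn /W_nested].
Qed.

Lemma S_mono m n : (m <= n)%N -> S n <= S m.
Proof.
have S1 j : S j.+1 <= S j.
  have [|z Cz _] := @C_hit j 0; first by rewrite (Fnorm0 FN).
  by have := CN Cz; have := Fnorm_ge0 FN z; lra.
elim: n => [|n IH]; first by rewrite leqn0 => /eqP ->.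
by rewrite leq_eqVlt => /predU1P[-> //|/IH]; exact: le_trans.
Qed.

(** The terms of the finite solutions converge along an ultrafilter, each in
    its compact set.  The distance to W j passes to the limit because the
    tails after m are small uniformly in the finite solutions, being at most
    S m. *)
Lemma exists_prescribed_distances : exists x, forall n, dist N x (W n) = c n.
Proof.
have [zz Hzz] := choice finite_prescribed_distances.
have [rr Hrr] := choice Hzz.
have [U [UU Ufine]] := ultraFilterLemma (@eventually_filter).
have U_ge m : U [set n | (m <= n)%N] by apply: Ufine; exact: nbhs_infty_ge.
have zU j : exists p, C j p /\ zz^~ j @ U --> p.
  have [|p Cp pU] := ultra_compact_cvg UU (@C_compact j) (f := zz^~ j).
    by apply: filterS (U_ge j.+1) => n /= jn; have [/(_ _ jn)[]] := Hrr n.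
  by exists p.
have [zeta zetaP] := choice zU.
pose s m := \sum_(i < m) zeta i.
have s_tail m n : (m <= n)%N -> N (s n - s m) <= S m - S n.
  elim: n => [|n IH].
    by rewrite leqn0 => /eqP ->; rewrite !subrr (Fnorm0 FN).
  rewrite leq_eqVlt => /predU1P[-> |/IH mn].
    by rewrite !subrr (Fnorm0 FN).
  rewrite /s big_ord_recr /= -/(s n) addrAC.
  have := Fnorm_triangle FN (s n - s m) (zeta n).
  by have := CN (zetaP n).1; lra.
have [x sx] : exists x : X, s @ \oo --> x.
  apply: (Frechet_complete XF) => eps eps0; have [M SM] := S_cvg0 eps0.
  exists M; have H m n : (M <= m)%N -> (m <= n)%N -> N (s n - s m) < eps.
    move=> Mm mn; have := s_tail _ _ mn.
    by have := S_mono Mm; have := S_ge0 n; lra.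
  move=> m n Mm Mn; case/orP: (leq_total m n) => [mn|nm]; last exact: H.
  by rewrite (Fnorm_distC FN); exact: H.
exists x => j.
(* An n far enough along the ultrafilter gives a finite solution rr n 0 within
   eps of x, and n > j makes its distance to W j equal to c j.  The error eps
   is split in three: the tail of x, its first m terms, the tail of rr n 0. *)
apply/eqP; rewrite -subr_eq0 -normr_le0.
apply/ler_addgt0Pr => eps eps0; rewrite add0r.
pose d := eps / 3; have d0 : 0 < d by rewrite /d; lra.
have [m0 Sm0] := S_cvg0 d0.
have /(Frechet_cvgP XF (fmap_filter _ _)) /(_ _ d0) [m1 _ m1P] := sx.
pose m := maxn m0 m1.
have Smd : S m < d by apply: le_lt_trans Sm0; exact/S_mono/leq_maxl.
have smd : N (x - s m) < d by apply: m1P => /=; exact: leq_maxr.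
have Usum k : forall eps', 0 < eps' ->
    U [set n | N (s k - \sum_(i < k) zz n i) < eps'].
  elim: k => [|k IH] eps' e0.
    by apply: filterS filterT => n _; rewrite /= /s !big_ord0 subrr (Fnorm0 FN).
  have e2 : 0 < eps' / 2 by lra.
  have Uk : U [set n | N (zeta k - zz n k) < eps' / 2].
    by have /(Frechet_cvgP XF (fmap_filter _ _)) /(_ _ e2) := (zetaP k).2.
  apply: filterS (filterI (IH _ e2) Uk) => n [/=].
  rewrite /s !big_ord_recr /= opprD addrACA => A1 A2.
  by apply: le_lt_trans (Fnorm_triangle FN _ _) _; lra.
have [n /= [[nm nj] ns]] :=
  filter_ex (filterI (filterI (U_ge m) (U_ge j.+1)) (Usum m d d0)).
have [zC zr rN] := Hrr n.
have r0 k : (k <= n)%N -> rr n 0 = \sum_(i < k) zz n i + rr n k.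
  elim: k => [|k IH] kn; first by rewrite big_ord0 add0r.
  by rewrite IH ?(ltnW kn)// big_ord_recr /= -addrA -zr.
have xr : N (x - rr n 0) <= d + d + d.
  rewrite (r0 _ nm).
  have := Fnorm_path FN (s m) x (\sum_(i < m) zz n i + rr n m).
  rewrite opprD (addrA (s m)).
  have := Fnorm_triangle FN (s m - \sum_(i < m) zz n i) (- rr n m).
  by rewrite (FnormN FN); have := rN m; lra.
have -> : c j = dist N (rr n 0) (W j).
  rewrite -(zC j nj).2; apply/esym/(dist_translate FN (subW _)).
  rewrite (r0 _ (ltnW nj)) addrK.
  elim/big_ind: _ => [|u v|i _]; [exact: subspace0|exact: subspaceD|].
  apply: (W_mono (ltn_ord i)); apply: CW; apply: (zC _ _).1.
  exact: ltn_trans nj.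
have := dist_lip FN (subW j) x (rr n 0).
have := dist_lip FN (subW j) (rr n 0) x.
by rewrite (Fnorm_distC FN (rr n 0)) ler_norml; move: xr; rewrite /d; lra.
Qed.
End BackwardSelection.

(** * The weighted series *)

(** Source of the recurrence S_n = e_n + delta_n + 2 S_(n+1): each weight with
    j > n is twice the weight of j in the series that starts at n+1. *)
Lemma doubling_series (R : realType) (a : nat -> R) (n : nat) :
  (forall j, (n <= j)%N -> 0 <= a j) ->
  (\sum_(n <= j <oo) (2 ^+ (j - n) * a j)%:E =
   (a n)%:E + 2%:E * \sum_(n.+1 <= j <oo) (2 ^+ (j - n.+1) * a j)%:E)%E.
Proof.
move=> a0.
rewrite (nneseries_split n 1); last first.
  by move=> j nj; rewrite lee_fin mulr_ge0 ?exprn_ge0 ?a0.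
rewrite addn1 big_nat1 subnn expr0 mul1r; congr (_ + _)%E.
(* Truncated below n.+1 so as to be nonnegative at every index. *)
pose f j := if (n < j)%N then (2 ^+ (j - n.+1) * a j)%:E else 0%E.
have fE (g h : nat -> \bar R) : (forall j, (n < j)%N -> g j = h j) ->
  (\sum_(n.+1 <= j <oo) g j = \sum_(n.+1 <= j <oo) h j)%E.
  move=> gh; apply: congr_lim; apply/funext => m.
  by apply: eq_big_nat => j /andP[nj _]; exact: gh.
rewrite (fE _ (fun j => 2%:E * f j)%E); last first.
  by move=> j nj; rewrite /f nj -EFinM mulrA -exprS -subSn // subSS.
rewrite nneseriesZl; last first.
  move=> j _; rewrite /f; case: ifP => // nj.
  by rewrite lee_fin mulr_ge0 ?exprn_ge0 ?a0 // ltnW.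
by congr (_ * _)%E; apply: fE => j nj; rewrite /f nj.
Qed.

Unset Implicit Arguments.

Theorem theorem2p5 (R : realType) (k : scalar_kind)
    (X : topologicalLmodType (scalar_field R k)) (N : X -> R)
    (V : nat -> set X) (e delta : nat -> R)
    (XF : is_Frechet N)
    (Xinf : ~ finite_dimensional X)
    (Vsub : forall n : nat, (0 < n)%N -> submod_closed [in V n])
    (Vnested : forall n : nat, (0 < n)%N -> V n `<=` V n.+1)
    (Vclosure : forall n : nat, (0 < n)%N -> closure (V n) `<=` V n.+1)
    (e_gt0 : forall n : nat, (0 < n)%N -> 0 < e n)
    (e_decr : forall n : nat, (0 < n)%N -> e n.+1 <= e n)
    (delta_gt0 : forall n : nat, (0 < n)%N -> 0 < delta n)
    (e_delta : forall n : nat, (0 < n)%N ->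
       (\sum_(n <= j <oo) (2 ^+ (j - n) * (e j + delta j))%:E
          < Order.min (e_ext e n.-1) (deviation N V n))%E) :
  exists x : X, forall n : nat, (0 < n)%N -> dist N x (V n) = e n.
Proof.
have [iota [iota0 iota1 iota_cont]] := scalar_line R k.
pose T n : \bar R := (\sum_(n <= j <oo) (2 ^+ (j - n) * (e j + delta j))%:E)%E.
have a_ge0 n j : (0 < n)%N -> (n <= j)%N -> 0 <= e j + delta j.
  move=> n0 nj.
  by rewrite addr_ge0 // ltW // ?e_gt0 ?delta_gt0 // (leq_trans n0).
have T_ge0 n : (0 < n)%N -> (0 <= T n)%E.
  move=> n0; apply: nneseries_ge0 => j nj _.
  by rewrite lee_fin mulr_ge0 ?exprn_ge0 ?(a_ge0 _ _ n0).
(* From here on indices start at 0: S n is the series attached to V n.+1. *)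
pose S n := fine (T n.+1).
have TS n : T n.+1 = (S n)%:E.
  rewrite fineK // ge0_fin_numE ?T_ge0 //.
  exact: lt_le_trans (e_delta n.+1 isT) (leey _).
have S_ge0 n : 0 <= S n by exact/fine_ge0/T_ge0.
have S_rec n : S n = e n.+1 + delta n.+1 + 2 * S n.+1.
  apply: EFin_inj; rewrite -TS /T doubling_series; last first.
    by move=> j; exact: a_ge0.
  by rewrite -/(T n.+2) TS -EFinM -EFinD.
have S_lt n : S n.+1 < e n.+1.
  by have := e_delta n.+2 isT; rewrite -/(T n.+2) TS lt_min lte_fin => /andP[].
have S_dev n : exists2 w, V n.+2 w & S n < dist N w (V n.+1).
  have := e_delta n.+1 isT; rewrite -/(T n.+1) TS lt_min => /andP[_].
  by move=> /ereal_sup_gt[_ [w Vw <-]]; rewrite lte_fin => ?; exists w.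
have S_geo n : S n * 2 ^+ n <= S 0%N.
  elim: n => [|n IH]; first by rewrite expr0 mulr1.
  apply: le_trans IH; rewrite exprS mulrA ler_wpM2r ?exprn_ge0 //.
  by have := S_rec n; have := a_ge0 _ _ (ltn0Sn n) (leqnn n.+1); lra.
have levels n : exists C : set X, [/\ compact C, C `<=` V n.+2,
    forall z, C z -> N z <= S n - S n.+1 &
    forall y, N y <= S n.+1 ->
      exists2 z, C z & dist N (z + y) (V n.+1) = e n.+1].
  have [w Vw Sw] := S_dev n.
  have := S_rec n; have := delta_gt0 n.+1 isT; have := S_ge0 n.+1 => s0 d0 Sn.
  (* delta n.+1 is the slack between e n.+1 + S n.+1 and S n - S n.+1. *)
  apply: (compact_level XF iota0 iota1 iota_cont (w := w)) => //.
  - exact: Vsub.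
  - exact: Vsub.
  - exact: Vnested.
  - by lra.
  - by lra.
have [C CP] := choice levels.
have [||||||||x xP] := @exists_prescribed_distances R _ X N
  (fun n => V n.+1) C S (fun n => e n.+1) XF.
- by move=> n; exact: Vsub.
- by move=> n; exact: Vnested.
- by move=> n; case: (CP n).
- by move=> n; case: (CP n).
- by move=> n; case: (CP n).
- by move=> n; case: (CP n).
- exact: S_ge0.
- move=> eps eps0; pose m := Num.bound (S 0%N / eps); exists m.
  rewrite -(ltr_pM2r (_ : 0 < 2 ^+ m)) ?exprn_gt0 //.
  apply: le_lt_trans (S_geo m) _; rewrite mulrC -ltr_pdivrMr //.
  apply: (@lt_le_trans _ _ m%:R).
    by apply: archi_boundP; rewrite divr_ge0 // ltW.
  by rewrite -natrX ler_nat ltnW // ltn_expl.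
by exists x => -[//|n] _; exact: xP.
Qed.
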